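(* Let $p\in\mathbb{N}$ and let $a_0,a_1,\ldots,a_p$ be the real coefficients in the expansion $(1-\cos\beta x)^p=\sum_{k=0}^pa_k\cos k\beta x$. Then $$a_k=\begin{cases}-\dfrac{(2p)!}{2^p\displaystyle\prod_{2\le m\le p}(m^2-1)} & \text{if }k=1,\\[6mm] (-1)^p\dfrac{(2p)!}{2^p\displaystyle\prod_{\substack{0\le m\le p\\ m\neq k}}(k^2-m^2)} & \text{if }2\le k\le p.\end{cases}$$
   Context: $\mathbb{N}=\{1,2,3,\ldots\}$. The coefficients $a_0,\ldots,a_p$ (depending on $p$ only) are the unique real numbers such that $(1-\cos\beta x)^p=\sum_{k=0}^pa_k\cos k\beta x$ holds for all $\beta,x\in\mathbb{R}$. Products over an empty index set equal $1$; the index $m$ runs over integers. *)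

(* Defs.v *)
From mathcomp Require Import all_boot all_order all_algebra.
From mathcomp Require Import reals trigo.
Set Implicit Arguments.
Unset Strict Implicit.
Unset Printing Implicit Defensive.

(* Main.v *)
Require Import Defs.
From mathcomp Require Import all_boot all_order all_algebra.
From mathcomp Require Import reals trigo.
From mathcomp Require Import ring zify.
Set Implicit Arguments.
Unset Strict Implicit.
Unset Printing Implicit Defensive.
Import Order.TTheory GRing.Theory Num.Theory.
Local Open Scope ring_scope.

(** Up to sign and scale, (1 - cos x)^p is a (2p)-th finite difference of the
cosine: a second difference with step x multiplies cos by 2 cos x - 2 (and
recentres it), so applying it p times gives, at the starting point - p x,
  (-2)^p (1 - cos x)^p = sum_(j <= 2p) (-1)^j C(2p, j) cos ((j - p) x).
Since the cosine is even, the terms j = p + k and j = p - k merge, and the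
coefficient of cos (k x) in (1 - cos x)^p is 2 (-1)^k C(2p, p + k) / 2^p for
k > 0 ([one_sub_cos_expansion]).

The functions cos (k x) are linearly independent ([cos_sum_eq0]), so the given
coefficients must be these.

It remains to recognise the stated products. Factoring k^2 - m^2 as
(k - m) (k + m) and collecting factorials shows that twice the product over
m <= p, m != k is (-1)^(p - k) (p - k)! (p + k)! ([prod_sqrB_neq]), which turns
(2p)! divided by the product into the binomial coefficient. The case k = 1 is
the same formula: the factor m = 0 is 1 and the p - 1 other factors change
sign ([prod_sqrB_neq1]). *)

(** * Linear independence of the cosines *)

Lemma cosD_cosB (R : realType) (u v : R) :
  cos (u + v) + cos (u - v) = 2 * cos u * cos v.
Proof. by rewrite cosD cosB; ring. Qed.

(** The operator f |-> f (x + t) + f (x - t) - 2 cos (n t) f (x) multiplies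
cos (k x) by 2 (cos (k t) - cos (n t)). It kills the mode k = n, and for
t = pi / n it multiplies every lower mode by a nonzero factor, because cos is
injective on [0, pi]; induction on the number of modes then applies. *)
Lemma cos_sum_eq0 (R : realType) (n : nat) (c : nat -> R) :
  (forall x, \sum_(0 <= k < n) c k * cos (k%:R * x) = 0) ->
  forall k, (k < n)%N -> c k = 0.
Proof.
elim: n c => [//|n IHn] c hc.
pose t : R := pi / n%:R.
have lower k : (k < n)%N -> c k = 0.
  move=> lt_kn.
  have n_gt0 : 0 < n%:R :> R by rewrite ltr0n; apply: leq_ltn_trans lt_kn.
  have cos_neq : cos (k%:R * t) - cos (n%:R * t) != 0.
    have nt : n%:R * t = pi by rewrite /t mulrC divfK ?gt_eqF.
    have pi_ge0 := @pi_ge0 R.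
    rewrite subr_eq0; apply/eqP => /cos_inj; rewrite !in_itv /= nt lexx pi_ge0.
    have kt : k%:R * t < pi.
      by rewrite -nt ltr_pM2r ?ltr_nat // divr_gt0 ?pi_gt0.
    have kt0 : 0 <= k%:R * t by rewrite mulr_ge0 ?divr_ge0 // ltW.
    rewrite kt0 (ltW kt) => /(_ isT isT) E.
    by rewrite E ltxx in kt.
  apply: (mulIf cos_neq); rewrite mul0r.
  apply: (IHn (fun j => c j * (cos (j%:R * t) - cos (n%:R * t)))) => // x.
  pose f y := \sum_(0 <= i < n.+1) c i * cos (i%:R * y).
  have mode i : c i * cos (i%:R * (x + t)) + c i * cos (i%:R * (x - t))
      - 2 * cos (n%:R * t) * (c i * cos (i%:R * x))
      = 2 * (c i * (cos (i%:R * t) - cos (n%:R * t)) * cos (i%:R * x)).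
    have := cosD_cosB (i%:R * x) (i%:R * t); rewrite -mulrDr -mulrBr => E.
    by rewrite -mulrDr E; ring.
  have : f (x + t) + f (x - t) - 2 * cos (n%:R * t) * f x = 0.
    by rewrite /f !hc; ring.
  rewrite /f -big_split /= mulr_sumr -sumrB.
  rewrite (eq_bigr _ (fun i _ => mode i)).
  rewrite -mulr_sumr big_nat_recr //= subrr mulr0 mul0r addr0.
  by move/eqP; rewrite mulf_eq0 pnatr_eq0 /= => /eqP.
move=> k; rewrite ltnS leq_eqVlt => /predU1P[->|/lower //].
(* Only the mode n is left; evaluating at 0 isolates its coefficient. *)
have := hc 0; rewrite big_nat_recr //= mulr0 cos0 mulr1 big_nat big1 ?add0r //.
by move=> i /= /lower ->; rewrite mul0r.
Qed.

(** * Finite differences of the cosine *)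

(** The n-th finite difference of cos at y with step x, up to the sign
(-1)^n: each step takes f y to f y - f (y + x). *)
Definition cos_diff (R : realType) (x : R) (n : nat) (y : R) : R :=
  \sum_(0 <= j < n.+1) (-1) ^+ j * 'C(n, j)%:R * cos (y + j%:R * x).

(** This is Pascal's rule. *)
Lemma cos_diffS (R : realType) (x : R) n (y : R) :
  cos_diff x n.+1 y = cos_diff x n y - cos_diff x n (y + x).
Proof.
rewrite /cos_diff big_nat_recl // bin0.
under eq_big_nat => j _ do rewrite binS natrD mulrDr mulrDl.
rewrite big_split /= addrA; congr (_ + _).
  rewrite [RHS]big_nat_recl // bin0; congr (_ + _).
  by rewrite big_nat_recr //= bin_small // mulr0 mul0r addr0.
rewrite -sumrN; apply: eq_bigr => j _.
rewrite exprS mulN1r !mulNr; congr (- (_ * cos _)).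
by rewrite -addn1 natrD; ring.
Qed.

(** A double step is
cos (z - x) - 2 cos z + cos (z + x) = (2 cos x - 2) cos z, so each one
contributes a factor and moves the centre by x. *)
Lemma cos_diff_even (R : realType) (x : R) n (y : R) :
  cos_diff x (2 * n) y = (2 * cos x - 2) ^+ n * cos (y + n%:R * x).
Proof.
elim: n y => [|n IHn] y.
  by rewrite /cos_diff big_nat1 bin0 !expr0 !mul1r.
rewrite (_ : 2 * n.+1 = (2 * n).+2)%N; last by lia.
rewrite !cos_diffS !IHn -!addrA exprS.
rewrite (_ : y + n.+1%:R * x = y + n%:R * x + x); last by rewrite -natr1; ring.
rewrite (_ : y + (x + n%:R * x) = y + n%:R * x + x); last by ring.
set z := y + n%:R * x + x.
rewrite (_ : y + n%:R * x = z - x); last by rewrite /z; ring.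
rewrite (_ : y + (x + (x + n%:R * x)) = z + x); last by rewrite /z; ring.
have := cosD_cosB z x; rewrite addrC => E; move: E.
set A := cos (z - x); set B := cos (z + x) => E.
rewrite (_ : A = 2 * cos z * cos x - B); last by rewrite -E; ring.
ring.
Qed.

Lemma sum_fold (V : nmodType) (F : nat -> V) p :
  \sum_(0 <= j < (2 * p).+1) F j =
  F p + \sum_(0 <= k < p) (F (p + k.+1)%N + F (p - k.+1)%N).
Proof.
rewrite (@big_cat_nat _ _ _ p) //=; last by lia.
rewrite big_split /= addrA addrC; congr (_ + _); last first.
  by rewrite big_nat_rev.
rewrite big_ltn; last by lia.
congr (_ + _); rewrite -{1}[p.+1]add0n big_addn.
rewrite (_ : ((2 * p).+1 - p.+1)%N = p); last by lia.
by apply: eq_bigr => k _; congr F; lia.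
Qed.

(** The factor [(k != 0).+1] is 2 for k > 0, where two opposite frequencies
merge, and 1 for k = 0. *)
Definition cos_coef (R : fieldType) (p k : nat) : R :=
  (-1) ^+ k * 'C(2 * p, p + k)%:R *+ (k != 0%N).+1 / 2 ^+ p.

Lemma one_sub_cos_expansion (R : realType) (p : nat) (x : R) :
  (1 - cos x) ^+ p = \sum_(0 <= k < p.+1) cos_coef R p k * cos (k%:R * x).
Proof.
have two_neq0 : (2 : R) ^+ p != 0 by rewrite expf_neq0 // pnatr_eq0.
have := cos_diff_even x p (- (p%:R * x)).
rewrite addNr cos0 mulr1.
rewrite (_ : 2 * cos x - 2 = (-1) * (2 * (1 - cos x))); last by ring.
rewrite !exprMn.
rewrite /cos_diff sum_fold addNr cos0 mulr1 => E.
have sq : (-1) ^+ p * (-1) ^+ p = 1 :> R by rewrite -exprMn mulrNN mulr1 expr1n.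
(* The sign (-1)^p comes from (2 cos x - 2)^p; multiplying by it once more
   clears it. *)
apply: (mulfI two_neq0).
rewrite -[LHS]mul1r -[X in X * _]sq -mulrA -E mulrDr mulrA sq mul1r.
rewrite big_nat_recl // mulrDr; congr (_ + _).
  by rewrite /cos_coef addn0 mul0r cos0 mulr1 mul1r mulr1n mulrCA divff // mulr1.
rewrite !mulr_sumr; apply: eq_big_nat => k /= lt_kp.
have -> : 'C(2 * p, p - k.+1) = 'C(2 * p, p + k.+1).
  by rewrite -bin_sub; [congr 'C(_, _)|]; lia.
have -> : (-1) ^+ (p - k.+1) = (-1) ^+ (p + k.+1) :> R.
  by rewrite -signr_odd oddB // -oddD signr_odd.
have -> : - (p%:R * x) + (p + k.+1)%:R * x = k.+1%:R * x by rewrite natrD; ring.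
have -> : - (p%:R * x) + (p - k.+1)%:R * x = - (k.+1%:R * x).
  by rewrite natrB //; ring.
rewrite cosN exprD /cos_coef /=.
set s := (-1) ^+ p in sq *; set u := _ ^+ k.+1; set C := _%:R; set z := cos _.
rewrite [LHS](_ : _ = s * s * (u * C * z * 2)); last by ring.
by rewrite sq; field.
Qed.

(** * The products of differences of squares *)

Lemma fact_pred n : (0 < n)%N -> n`! = (n * n.-1`!)%N.
Proof. by case: n. Qed.

(** The factors k - m run down from k and fill k! once multiplied by (k - j)!;
the factors k + m run up from k and extend (k - 1)! to (k + j - 1)!. A common
factor (k - 1)! has been cancelled. *)
Lemma prod_sqrB_lt (R : comNzRingType) (k j : nat) : (0 < k)%N -> (j <= k)%N ->
  (\prod_(0 <= m < j) (k%:R ^+ 2 - m%:R ^+ 2)) * (k - j)`!%:R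
  = k%:R * (k + j).-1`!%:R :> R.
Proof.
move=> k_gt0; elim: j => [|j IHj] lt_jk.
  by rewrite big_nil mul1r subn0 addn0 -natrM -fact_pred.
have := IHj (ltnW lt_jk).
have -> : ((k - j)`! = (k - j) * (k - j.+1)`!)%N.
  by rewrite fact_pred ?subn_gt0 // subnS.
have -> : ((k + j.+1).-1`! = (k + j) * (k + j).-1`!)%N.
  by rewrite addnS /= -fact_pred // addn_gt0 k_gt0.
rewrite big_nat_recr //= !natrM natrD natrB 1?ltnW // => E.
rewrite [RHS]mulrCA -E; ring.
Qed.

(** Induction on p from p = k: the base case is the product over m < k, and each
further factor k^2 - (p + 1)^2 = - (p + 1 - k) (p + 1 + k) extends the sign and
both factorials. The factor 2 appears because the base case is k (2k - 1)!,
half of (2k)!. *)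
Lemma prod_sqrB_neq (R : comNzRingType) (k p : nat) : (0 < k <= p)%N ->
  2 * \prod_(0 <= m < p.+1 | m != k) (k%:R ^+ 2 - m%:R ^+ 2)
  = (-1) ^+ (p - k) * (p - k)`!%:R * (p + k)`!%:R :> R.
Proof.
case/andP=> k_gt0 /subnK <-; elim: (p - k)%N => [|q IHq].
  rewrite add0n subnn fact0 expr0 !mul1r big_mkcond big_nat_recr //= eqxx mulr1.
  rewrite -big_mkcond big_nat_cond (eq_bigl (fun m => (0 <= m < k)%N)); last first.
    by move=> m; rewrite /=; case: ltngtP.
  rewrite -big_nat; have := @prod_sqrB_lt R k k k_gt0 (leqnn k).
  rewrite subnn fact0 mulr1 => ->.
  by rewrite (@fact_pred (k + k)) ?addn_gt0 ?k_gt0 // natrM natrD; ring.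
rewrite addSn big_mkcond big_nat_recr //= -big_mkcond.
have -> : (q + k).+1 != k by rewrite neq_ltn ltnS leq_addl orbT.
rewrite mulrA IHq -[(q + k).+1]addSn !addnK.
have -> : ((q.+1 + k + k)`! = (q + k + k).+1 * (q + k + k)`!)%N by [].
by rewrite factS (exprS (-1)) !natrM addSn -!natr1 !natrD; ring.
Qed.

Lemma prod_sqrB_neq1 (R : comNzRingType) (p : nat) : (0 < p)%N ->
  \prod_(0 <= m < p.+1 | m != 1%N) (1%:R ^+ 2 - m%:R ^+ 2)
  = (-1) ^+ p.-1 * \prod_(2 <= m < p.+1) (m%:R ^+ 2 - 1) :> R.
Proof.
case: p => // p _; rewrite big_mkcond big_ltn // big_ltn //= mul1r.
rewrite expr1n expr0n subr0 mul1r -big_mkcond /=.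
have -> : (-1) ^+ p = \prod_(2 <= m < p.+2) (-1) :> R.
  by rewrite big_const_nat iter_mulr_1 !subSS subn0.
rewrite -big_split /= big_nat_cond [RHS]big_nat_cond.
apply: eq_big => [m|m _]; last by rewrite mulN1r opprB.
by case: (ltngtP m 1) => //; case: m => [|[|m]].
Qed.

(** * The closed form of the coefficients *)

Lemma cos_coefE (R : numFieldType) (k p : nat) : (0 < k <= p)%N ->
  cos_coef R p k = (-1) ^+ p * ((2 * p)`!%:R /
    (2 ^+ p * \prod_(0 <= m < p.+1 | m != k) (k%:R ^+ 2 - m%:R ^+ 2))).
Proof.
move=> kp; have := prod_sqrB_neq R kp; case/andP: kp => k_gt0 le_kp.
have fact_neq0 n : n`!%:R != 0 :> R by rewrite pnatr_eq0 -lt0n fact_gt0.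
have <- : ('C(2 * p, p + k) * ((p + k)`! * (p - k)`!) = (2 * p)`!)%N.
  rewrite -(@bin_fact (2 * p) (p + k)); last by lia.
  by congr (_ * (_ * _`!))%N; lia.
have -> : (-1) ^+ p = (-1) ^+ (p - k) * (-1) ^+ k :> R by rewrite -exprD subnK.
set P := \prod_(_ <= _ < _ | _) _ => EP.
have -> : P = (-1) ^+ (p - k) * (p - k)`!%:R * (p + k)`!%:R / 2.
  by rewrite -EP mulrC mulKf // pnatr_eq0.
rewrite /cos_coef -lt0n k_gt0 !natrM /=; field.
by rewrite !fact_neq0 signr_eq0 expf_neq0 // pnatr_eq0.
Qed.

Theorem theorem5p2 (R : realType) (p : nat) (hp : (1 <= p)%N) (a : nat -> R)
  (ha : forall beta x : R,
      (1 - cos (beta * x)) ^+ p =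
      \sum_(0 <= k < p.+1) a k * cos (k%:R * beta * x)) :
  a 1%N = - ((2 * p)`!%:R /
             (2 ^+ p * \prod_(2 <= m < p.+1) (m%:R ^+ 2 - 1)))
  /\
  (forall k : nat, (2 <= k <= p)%N ->
     a k = (-1) ^+ p * ((2 * p)`!%:R /
             (2 ^+ p * \prod_(0 <= m < p.+1 | m != k)
                         (k%:R ^+ 2 - m%:R ^+ 2)))).
Proof.
have aE k : (0 < k <= p)%N -> a k = (-1) ^+ p * ((2 * p)`!%:R /
    (2 ^+ p * \prod_(0 <= m < p.+1 | m != k) (k%:R ^+ 2 - m%:R ^+ 2))).
  move=> kp; rewrite -cos_coefE //; apply/eqP; rewrite -subr_eq0; apply/eqP.
  apply: (@cos_sum_eq0 R p.+1 (fun j => a j - cos_coef R p j)); last first.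
    by case/andP: kp.
  move=> x; have := ha 1 x; rewrite mul1r one_sub_cos_expansion => /esym/eqP.
  rewrite -subr_eq0 -sumrB => /eqP E; rewrite -[RHS]E.
  by apply: eq_bigr => i _; rewrite mulr1 mulrBl.
split=> [|k /andP[k_gt1 le_kp]]; last by apply: aE; rewrite (ltnW k_gt1).
rewrite aE // prod_sqrB_neq1 //; set P := \prod_(_ <= _ < _) _.
have -> : (-1) ^+ p = - (-1) ^+ p.-1 :> R.
  by rewrite -[in LHS](prednK hp) exprS mulN1r.
rewrite mulNr (mulrCA (2 ^+ p)) (invfM (_ ^+ _) (_ * _)) invr_sign.
by rewrite mulrCA signrMK.
Qed.
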